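(* Let $P=\{p_1,\ldots,p_m\}$ be a finite poset numbered so that $p_i<p_j$ implies $i<j$, let $A_1,\ldots,A_m$ be non-empty subsets of $[n]$, and let $\mathfrak{A}$ be a poset ideal of $\mathrm{Hom}(P,A_1,\ldots,A_m)$. Then the ideal $\mathcal{L}(\mathfrak{A})\subseteq R$ has a multigraded minimal free resolution of the form $$\mathbb{F}:\quad 0\to F_p\xrightarrow{d_p}F_{p-1}\xrightarrow{d_{p-1}}\cdots\xrightarrow{d_1}F_0\xrightarrow{d_0}\mathcal{L}(\mathfrak{A})\to 0,$$ described as follows. (Bases.) For $0\le t\le p$, $F_t$ is the free $R$-module with basis consisting of the symbols $[K_1,\ldots,K_m]$, of multidegree $X_{p_1,K_1}\cdots X_{p_m,K_m}$, satisfying: (1) $\emptyset\ne K_i\subseteq A_i$ for all $i=1,\ldots,m$; (2) $|K_1|+\cdots+|K_m|=m+t$; (3) $\max(K_i)\le\min(K_j)$ whenever $p_i<p_j$, $1\le i<j\le m$; (4) $(\widehat{K_1},\widehat{K_2},\ldots,\widehat{K_m})\in\mathfrak{A}$. The integer $p$, i.e. the projective dimension of $\mathcal{L}(\mathfrak{A})$, is the maximum value of $t$ for which there exist $K_1,\ldots,K_m$ satisfying (1)–(4). (Differentials.) For a basis element $[K_1,\ldots,K_m]$ of $F_0$, $d_0([K_1,\ldots,K_m])=X_{p_1,K_1}X_{p_2,K_2}\cdots X_{p_m,K_m}\in\mathcal{L}(\mathfrak{A})$. For $t\ge1$ and a basis element $[K_1,\ldots,K_m]$ of $F_t$, put $$\Omega=\{X_{p_i,a}\mid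 1\le i\le m,\ |K_i|\ge2,\ a\in K_i\},\qquad \overline{\Omega}=\{X_{p_i,a}\mid 1\le i\le m,\ a\in K_i\}.$$ Totally order $\overline{\Omega}$ by $X_{p_i,a}>X_{p_j,b}$ if and only if either $i<j$, or $i=j$ and $a<b$, and let $\sigma(X_{p_i,a},\overline{\Omega})$ be the number of elements of $\overline{\Omega}$ that are larger than $X_{p_i,a}$. Then $$d_t([K_1,\ldots,K_m])=\sum_{X_{p_i,a}\in\Omega}(-1)^{\sigma(X_{p_i,a},\overline{\Omega})}X_{p_i,a}[K_1,\ldots,K_i\setminus\{a\},\ldots,K_m].$$
   Context: $n$ is a positive integer, $[n]=\{1,\ldots,n\}$, $\mathbf{K}$ is a field, and $R=\mathbf{K}[X_{p,i}\mid p\in P,\ i\in[n]]$, with its $\mathbf{Z}^{P\times[n]}$-multigrading (multidegrees are written as monomials). A map $f:P\to[n]$ is isotone if $p\le q$ implies $f(p)\le f(q)$. $\mathrm{Hom}(P,A_1,\ldots,A_m)$ is the set of isotone maps $f:P\to[n]$ with $f(p_i)\in A_i$ for all $i$, partially ordered by $f\le g$ iff $f(p)\le g(p)$ for all $p\in P$. A map $f$ with $f(p_i)=a_i$ is also written as the vector $(a_1,\ldots,a_m)$. A poset ideal of a poset $Q$ is a non-empty subset $I\subseteq Q$ such that $y\in I$, $x\in Q$, $x\le y$ imply $x\in I$. For $f\in\mathrm{Hom}(P,A_1,\ldots,A_m)$, $U_f:=\prod_{p\in P}X_{p,f(p)}$, and $\mathcal{L}(\mathfrak{A}):=(U_f\mid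 f\in\mathfrak{A})\subseteq R$ (a ''generalized co-letterplace ideal''). For a non-empty $K\subseteq[n]$, $\widehat{K}:=\max(K)$ and $X_{p_i,K}:=\prod_{a\in K}X_{p_i,a}$. *)

(* Defs.v *)
From HB Require Import structures.
From mathcomp Require Import all_boot all_order all_algebra.
From mathcomp.multinomials Require Export mpoly.

Set Implicit Arguments.
Unset Strict Implicit.
Unset Printing Implicit Defensive.

Import Order.TTheory GRing.Theory.

Local Open Scope ring_scope.

Definition ideal_gen (R : comNzRingType) (J : finType) (S : {set J})
    (g : J -> R) : R -> Prop :=
  fun y => exists c : J -> R, y = \sum_(j in S) c j * g j.

Definition free_module (R : comNzRingType) (B : finType) : lmodType R :=
  {ffun B -> R^o}.

Definition basis_vector (R : comNzRingType) (B : finType) (b : B) :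
    free_module R B :=
  [ffun b' => (b' == b)%:R].

Definition projective (R : comNzRingType) (M : lmodType R) : Prop :=
  forall (V W : lmodType R) (g : {linear V -> W}) (f : {linear M -> W}),
    (forall w, exists v, g v = w) ->
    exists h : {linear M -> V}, forall x, g (h x) = f x.

(* Exactness of 0 -> M len -> ... -> M 0 -> L -> 0 for an ideal L of R. The
   sequence M is indexed by all of nat and vanishes beyond len; surjectivity
   onto L says that the image of d0, viewed as a map to R, is L. *)
Definition resolution (R : comNzRingType) (L : R -> Prop) (len : nat)
    (M : nat -> lmodType R) (d0 : {linear M 0 -> R^o})
    (d : forall t, {linear M t.+1 -> M t}) : Prop :=
  [/\ forall y : R, L y <-> exists x, d0 x = y,
      forall x, d0 x = 0 <-> exists y, d 0 y = x,
      forall t x, d t x = 0 <-> exists y, d t.+1 y = x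
    & forall t (x : M t), (len < t)%N -> x = 0].

Definition has_projective_resolution (R : comNzRingType) (L : R -> Prop)
    (len : nat) : Prop :=
  exists (M : nat -> lmodType R) (d0 : {linear M 0 -> R^o})
         (d : forall t, {linear M t.+1 -> M t}),
    (forall t, projective (M t)) /\ resolution L len d0 d.

Definition projective_dimension (R : comNzRingType) (L : R -> Prop)
    (k : nat) : Prop :=
  has_projective_resolution L k /\
  forall j, has_projective_resolution L j -> (k <= j)%N.

(* x is homogeneous of multidegree alpha in the direct sum of the shifted
   modules R(- gdeg b), for b in B. *)
Definition homogeneous (K : fieldType) (N : nat) (B : finType)
    (gdeg : B -> 'X_{1..N}) (alpha : 'I_N -> int)
    (x : free_module {mpoly K[N]} B) : Prop :=
  forall (b : B) (u : 'X_{1..N}), u \in msupp (x b : {mpoly K[N]}) ->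
  forall i : 'I_N, (u i)%:Z + (gdeg b i)%:Z = alpha i.

Definition homogeneous_poly (K : fieldType) (N : nat)
    (alpha : 'I_N -> int) (f : {mpoly K[N]}) : Prop :=
  forall u : 'X_{1..N}, u \in msupp f -> forall i : 'I_N, (u i)%:Z = alpha i.

Definition irrelevant_ideal (K : fieldType) (N : nat) : {mpoly K[N]} -> Prop :=
  ideal_gen [set: 'I_N] (fun i => 'X_i).

(* Minimality is the condition d (M t.+1) \subset m M t, where m is the
   irrelevant ideal. *)
Definition multigraded_minimal_free_resolution (K : fieldType) (N : nat)
    (L : {mpoly K[N]} -> Prop) (len : nat) (B : nat -> finType)
    (gdeg : forall t, B t -> 'X_{1..N})
    (d0 : {linear free_module {mpoly K[N]} (B 0) -> {mpoly K[N]}^o})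
    (d : forall t, {linear free_module {mpoly K[N]} (B t.+1) ->
                           free_module {mpoly K[N]} (B t)}) : Prop :=
  [/\ resolution (M := fun t => free_module {mpoly K[N]} (B t)) L len d0 d,
      forall alpha x, homogeneous (gdeg 0) alpha x ->
        homogeneous_poly alpha (d0 x),
      forall t alpha x, homogeneous (gdeg t.+1) alpha x ->
        homogeneous (gdeg t) alpha (d t x)
    & forall t x b, irrelevant_ideal (d t x b)].

(* Throughout, [n] = {1, ..., n} is represented by 'I_n with its usual order,
   and the elements of the poset P are numbered by p : 'I_m -> P. *)

Definition poset_ideal (T : finType) (le : rel T) (Q I : {set T}) : Prop :=
  [/\ I != set0, I \subset Q
    & forall x y, y \in I -> x \in Q -> le x y -> x \in I].

Definition isotone disp (P : finPOrderType disp) n (f : {ffun P -> 'I_n}) :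
    bool :=
  [forall q, forall r, (q <= r)%O ==> (f q <= f r)%N].

Definition isotone_maps disp (P : finPOrderType disp) n m (p : 'I_m -> P)
    (A : 'I_m -> {set 'I_n}) : {set {ffun P -> 'I_n}} :=
  [set f | isotone f && [forall i, f (p i) \in A i]].

Definition le_map disp (P : finPOrderType disp) n : rel {ffun P -> 'I_n} :=
  fun f g => [forall q, (f q <= g q)%N].

Definition nvars disp (P : finPOrderType disp) n : nat := #|{: P * 'I_n}|.

Definition var disp (P : finPOrderType disp) n (q : P) (a : 'I_n) :
    'I_(nvars P n) :=
  enum_rank (q, a).

Definition Xvar (K : fieldType) disp (P : finPOrderType disp) n (q : P)
    (a : 'I_n) : {mpoly K[nvars P n]} :=
  'X_(var q a).

Definition Umon (K : fieldType) disp (P : finPOrderType disp) n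
    (f : {ffun P -> 'I_n}) : {mpoly K[nvars P n]} :=
  \prod_(q : P) Xvar K q (f q).

Definition coletterplace (K : fieldType) disp (P : finPOrderType disp) n
    (I : {set {ffun P -> 'I_n}}) : {mpoly K[nvars P n]} -> Prop :=
  ideal_gen I (@Umon K disp P n).

Arguments coletterplace K {disp P n} I _.

(* The values on the empty set are junk: only non-empty K_i are used. *)
Definition max_elt n (S : {set 'I_n}) : nat := \max_(a in S) a.
Definition min_elt n (S : {set 'I_n}) : nat := \big[minn/n]_(a in S) a.

Definition is_symbol disp (P : finPOrderType disp) n m (p : 'I_m -> P)
    (A : 'I_m -> {set 'I_n}) (I : {set {ffun P -> 'I_n}}) (t : nat)
    (s : {ffun 'I_m -> {set 'I_n}}) : bool :=
  [&& [forall i, (s i != set0) && (s i \subset A i)],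
      (\sum_i #|s i| == m + t)%N,
      [forall i : 'I_m, forall j : 'I_m,
         (i < j)%N && (p i < p j)%O ==> (max_elt (s i) <= min_elt (s j))%N]
    & [exists f in I, forall i, (f (p i) == max_elt (s i) :> nat)]].

Definition symbol disp (P : finPOrderType disp) n m (p : 'I_m -> P)
    (A : 'I_m -> {set 'I_n}) (I : {set {ffun P -> 'I_n}}) (t : nat) : finType :=
  {s : {ffun 'I_m -> {set 'I_n}} | is_symbol p A I t s}.

Definition symbol_mdeg disp (P : finPOrderType disp) n m (p : 'I_m -> P)
    (s : {ffun 'I_m -> {set 'I_n}}) : 'X_{1..nvars P n} :=
  (\sum_i \sum_(a in s i) U_(var (p i) a))%MM.

Definition X_symbol (K : fieldType) disp (P : finPOrderType disp) n m
    (p : 'I_m -> P) (s : {ffun 'I_m -> {set 'I_n}}) : {mpoly K[nvars P n]} :=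
  \prod_i \prod_(a in s i) Xvar K (p i) a.

(* The variable X_{p_i, a} is encoded by the pair (i, a). *)
Definition OmegaBar n m (s : {ffun 'I_m -> {set 'I_n}}) : {set 'I_m * 'I_n} :=
  [set x | x.2 \in s x.1].

Definition Omega n m (s : {ffun 'I_m -> {set 'I_n}}) : {set 'I_m * 'I_n} :=
  [set x | (2 <= #|s x.1|)%N && (x.2 \in s x.1)].

Definition var_gt n m (x y : 'I_m * 'I_n) : bool :=
  (x.1 < y.1)%N || (x.1 == y.1) && (x.2 < y.2)%N.

Definition sigma n m (x : 'I_m * 'I_n) (S : {set 'I_m * 'I_n}) : nat :=
  #|[set y in S | var_gt y x]|.

Definition symbol_del n m (s : {ffun 'I_m -> {set 'I_n}}) (x : 'I_m * 'I_n) :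
    {ffun 'I_m -> {set 'I_n}} :=
  [ffun i => if i == x.1 then s i :\ x.2 else s i].

Definition symbol_module (K : fieldType) disp (P : finPOrderType disp) n m
    (p : 'I_m -> P) (A : 'I_m -> {set 'I_n}) (I : {set {ffun P -> 'I_n}})
    (t : nat) : lmodType {mpoly K[nvars P n]} :=
  free_module {mpoly K[nvars P n]} (symbol p A I t).

(* Main.v *)
Require Import Defs.
From HB Require Import structures.
From mathcomp Require Import all_boot all_order all_algebra.
From mathcomp Require Import zify ring.
From Stdlib Require Import ClassicalEpsilon.

Set Implicit Arguments.
Unset Strict Implicit.
Unset Printing Implicit Defensive.

Import GRing.Theory.
Local Open Scope ring_scope.

(** A symbol [K_1, ..., K_m] is the same thing as the subset T of the grid of
    pairs (i, a) whose i-th row is K_i.  Read this way, the differential is the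
    simplicial boundary with each deleted vertex (i, a) weighted by the variable
    X_{p_i, a}; the faces left out, those deleting from a row with one element,
    are those with an empty row.  The sets T that come from symbols are called
    cells.  [is_cellP] describes them by conditions on pairs of vertices, plus
    the existence of a map in the poset ideal that bounds every vertex.  It is
    here that the ideal property is used: the map of row maxima lies in the
    ideal as soon as some member of the ideal bounds it.  So cells are stable
    under deleting a vertex as long as no row becomes empty.

    Exactness is checked one multidegree alpha at a time.  The alpha-strand of
    the complex is a complex of vector spaces, the cells contained in a fixed
    set D, namely the support of alpha, with unweighted boundary
    ([strand_boundary]).  In each row i let a_i be the least vertex that occurs
    in a cell inside D.  If the rows of a cell before row i are the singletons
    {a_j}, then the vertex (i, a_i) can be inserted ([is_cell_insert]):
    the elements of these rows satisfy the order conditions because the map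
    p_i -> a_i is isotone, and those of later rows because a_i lies below row i.
    Coning with (i, a_i) is therefore a homotopy that pushes a cycle onto the
    cells whose i-th row is {a_i}, without changing its class.  After
    all rows are treated only the single cell with rows {a_i} is left, and the
    augmentation decides whether the cycle is zero: this is [chain_exact].
    Polynomial chains are then put together from their strands ([diff_exact]).

    The entries of the differentials lie in the irrelevant ideal, and this
    forces the length to be the projective dimension.  If Q is a projective
    resolution of smaller length, the comparison maps F -> Q -> F are homotopic
    to the identity, and in the top degree of F the homotopy equation reduces
    to id = s d, since Q and the next module of F vanish there.
    Reducing the coefficients modulo the irrelevant ideal gives 1 = 0
    ([minimal_length_le]). *)

(** * Signed boundaries on subsets of an ordered set *)

Lemma sum_neq0 (V : nmodType) (J : finType) (Q : pred J) (F : J -> V) :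
  \sum_(j | Q j) F j != 0 -> exists2 j, Q j & F j != 0.
Proof.
move=> s0; have [j /andP[Qj Fj]|none] := pickP [pred j | Q j && (F j != 0)].
  by exists j.
case/eqP: s0; apply: big1 => j Qj.
by move: (none j); rewrite /= Qj => /negbT; rewrite negbK => /eqP.
Qed.

Section SignedBoundary.

Variables (E : finType) (gt : rel E).
Hypothesis gt_asym : forall x y, x != y -> gt x y = ~~ gt y x.

Definition rank_in (x : E) (S : {set E}) : nat := #|[set y in S | gt y x]|.

Lemma rank_inU1 x y (S : {set E}) :
  y \notin S -> rank_in x (y |: S) = (gt y x + rank_in x S)%N.
Proof.
move=> yS; rewrite /rank_in -!sum1_card.
rewrite (bigID (pred1 y)) /=; congr (_ + _)%N; last first.
  apply: eq_bigl => z; rewrite !inE.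
  by case: eqVneq => [->|]; rewrite ?(negPf yS) ?andbF ?andbT.
case yx: (gt y x); last first.
  by rewrite big_pred0 // => z; rewrite !inE; case: eqVneq => [->|];
    rewrite ?yx ?andbF.
by rewrite (big_pred1 y) // => z; rewrite !inE /=; case: eqVneq => [->|];
  rewrite ?yx ?andbF.
Qed.

Variables (R : comNzRingType) (U : pred {set E}).

(** The coefficient of S in the boundary of the chain c collects the cofaces
    x |: S.  The predicate U selects the subsets that are kept: since it is
    closed under adding vertices, this is a quotient of the simplicial chain
    complex.  The weights w make the same formula serve for polynomial and for
    scalar chains. *)
Definition boundary (w : E -> R) (c : {set E} -> R) (S : {set E}) : R :=
  if U S then \sum_(x | x \notin S) (-1) ^+ rank_in x S * w x * c (x |: S)
  else 0.

Hypothesis U_up : forall x S, U S -> U (x |: S).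

(** Deleting x and then y, or y and then x, gives opposite signs.  The double
    sum is split according to the order of x and y, rather than shown to equal
    its opposite, because the characteristic may be 2. *)
Lemma boundary_boundary w c S : boundary w (boundary w c) S = 0.
Proof.
rewrite {1}/boundary; case: ifP => // US.
pose t x y := (-1) ^+ rank_in x S * w x *
  ((-1) ^+ rank_in y (x |: S) * w y * c (y |: (x |: S))).
have -> : \sum_(x | x \notin S) (-1) ^+ rank_in x S * w x * boundary w c
  (x |: S)
   = \sum_(x | x \notin S) \sum_(y | (y \notin S) && (y != x)) t x y.
  apply: eq_bigr => x xS; rewrite /boundary U_up // mulr_sumr.
  by apply: eq_bigl => y; rewrite !inE negb_or andbC.
have tN x y : x \notin S -> y \notin S -> x != y -> t y x = - t x y.
  move=> xS yS xy; rewrite /t !rank_inU1 // (gt_asym xy) setUCA.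
  by case: (gt y x) => /=; rewrite ?add0n ?exprS; ring.
rewrite (eq_bigr (fun x => \sum_(y | (y \notin S) && gt x y && (y != x)) t x y +
   \sum_(y | (y \notin S) && gt y x && (y != x)) t x y)); last first.
  move=> x xS; rewrite (bigID (gt x)) /=; congr (_ + _); apply: eq_bigl => y.
    by rewrite andbAC.
  by case: (eqVneq y x) => [|yx]; rewrite ?andbF //= ?andbT (gt_asym yx).
rewrite big_split /= [X in _ + X](exchange_big_dep (fun y => y \notin S)) /=;
  last by move=> x y _ /andP[/andP[]].
rewrite -big_split big1 //= => x xS.
apply/eqP; rewrite addr_eq0 -sumrN; apply/eqP.
apply: eq_big => [y|y /andP[/andP[yS _] yx]].
  by rewrite xS /= [x == y]eq_sym andbA.
by rewrite tN ?opprK // eq_sym.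
Qed.

Lemma boundaryB w c1 c2 S :
  boundary w (fun T => c1 T - c2 T) S = boundary w c1 S - boundary w c2 S.
Proof.
rewrite /boundary; case: ifP => _; last by rewrite subr0.
by rewrite -sumrB; apply: eq_bigr => x _; rewrite mulrBr.
Qed.

Lemma boundaryD w c1 c2 S :
  boundary w (fun T => c1 T + c2 T) S = boundary w c1 S + boundary w c2 S.
Proof.
rewrite /boundary; case: ifP => _; last by rewrite addr0.
by rewrite -big_split; apply: eq_bigr => x _; rewrite mulrDr.
Qed.

Lemma eq_boundary w c1 c2 : c1 =1 c2 -> boundary w c1 =1 boundary w c2.
Proof.
move=> e S; rewrite /boundary; case: ifP => // _.
by apply: eq_bigr => x _; rewrite e.
Qed.

Lemma boundary_neq0 w c S : boundary w c S != 0 ->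
  U S /\ exists2 x, x \notin S & c (x |: S) != 0.
Proof.
rewrite /boundary; case: ifP => [US /sum_neq0[x xS cx]|_ /eqP//]; split=> //.
by exists x => //; apply: contraNneq cx => ->; rewrite mulr0.
Qed.

(** Summing all coefficients is the augmentation of the scalar complex; this
    exchange of sums reduces its value on a boundary to a signed count of the
    admissible faces of each subset. *)
Lemma sum_boundary w c :
  \sum_S boundary w c S =
  \sum_T c T * \sum_(x | (x \in T) && U (T :\ x))
                  (-1) ^+ rank_in x (T :\ x) * w x.
Proof.
have -> : \sum_S boundary w c S = \sum_(S | U S) \sum_(x | x \notin S)
  (-1) ^+ rank_in x S * w x * c (x |: S).
  by rewrite [RHS]big_mkcond; apply: eq_bigr => S _.
rewrite (exchange_big_dep xpredT) //=.
under [RHS]eq_bigr do rewrite mulr_sumr.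
rewrite [RHS](exchange_big_dep xpredT) //=; apply: eq_bigr => x _.
rewrite (reindex_onto (fun T => T :\ x) (fun S => x |: S)) /=; last first.
  by move=> S /andP[_ xS]; rewrite setU1K.
apply: eq_big => [T|T /andP[_ /eqP->]]; last by rewrite mulrC.
rewrite !inE eqxx /= andbT andbC; congr (_ && _).
apply/eqP/idP=> [<-|]; first by rewrite setU11.
by move/setD1K.
Qed.

(** Coning with a vertex a of weight 1 satisfies the homotopy identity
    boundary (cone c) + cone (boundary c) = c at every S in the family U, except
    when deleting a from S leaves U.  The two lemmas below are the cases
    of this identity needed when c is a cycle. *)
Section Cone.

Variables (a : E) (c : {set E} -> R).

Definition cone (S : {set E}) : R :=
  if a \in S then (-1) ^+ rank_in a (S :\ a) * c (S :\ a) else 0.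

Variables (w : E -> R).
Hypothesis wa1 : w a = 1.

Lemma boundary_cone_notin S : U S -> a \notin S -> boundary w cone S = c S.
Proof.
move=> US aS; rewrite /boundary US (bigD1 a) //= big1 => [|x /andP[xS xa]].
  by rewrite addr0 /cone setU11 setU1K // wa1 mulr1 mulrA -expr2 sqrr_sign
    mul1r.
by rewrite /cone !inE eq_sym (negPf xa) (negPf aS) mulr0.
Qed.

Lemma boundary_cone_in S : U (S :\ a) -> a \in S -> boundary w c (S :\ a) = 0 ->
  boundary w cone S = c S.
Proof.
move=> US aS; rewrite /boundary US -{4}(setD1K aS) U_up //.
rewrite (bigD1 a) ?inE ?eqxx //= wa1 mulr1 setD1K //.
(* The cycle condition at S :\ a expresses c S through the cofaces of S :\ a
   other than S, and these are what the cone sees around S. *)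
set s := \sum_(_ | _) _ => /eqP; rewrite addr_eq0 => /eqP cS.
have -> : c S = - ((-1) ^+ rank_in a (S :\ a) * s).
  by rewrite -mulrN -cS mulrA -expr2 sqrr_sign mul1r.
rewrite mulr_sumr -sumrN; apply: eq_big => x.
  by rewrite !inE negb_and negbK; case: eqVneq => [->|];
    rewrite ?aS ?andbF ?andbT.
move=> xS; have xa : x != a by apply: contraNneq xS => ->.
rewrite /cone inE aS orbT.
have -> : (x |: S) :\ a = x |: (S :\ a).
  by rewrite setDUl (setDidPl _) // disjoints1 inE.
rewrite -{1}(setD1K aS) !rank_inU1 ?inE ?eqxx ?(negPf xS) ?andbF //.
rewrite (gt_asym xa); case: (gt a x) => /=; rewrite ?add0n ?exprS; ring.
Qed.

End Cone.

End SignedBoundary.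

(** * Symbols as cells *)

Lemma var_gt_asym n m (x y : 'I_m * 'I_n) :
  x != y -> var_gt x y = ~~ var_gt y x.
Proof.
case: x y => i a [j b]; rewrite /var_gt /= xpair_eqE -!val_eqE /=; lia.
Qed.

Section Cells.

Variables (n : nat) (disp : Order.disp_t) (P : finPOrderType disp) (m : nat).
Variables (p : 'I_m -> P) (A : 'I_m -> {set 'I_n}).
Variable I : {set {ffun P -> 'I_n}}.
Hypothesis p_bij : bijective p.
Hypothesis p_num : forall i j : 'I_m, (p i < p j)%O -> (i < j)%N.
Hypothesis I_ideal : poset_ideal (@le_map disp P n) (isotone_maps p A) I.

Local Notation E := ('I_m * 'I_n)%type.

Definition rowful (T : {set E}) : bool := [forall i, [exists a, (i, a) \in T]].

(** The condition on maxima of rows is replaced by a bound on all vertices by a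
    member of I.  In this form every condition except [rowful] visibly passes to
    subsets, and inserting a vertex below an existing one is harmless. *)
Definition is_cell (T : {set E}) : bool :=
  [&& rowful T,
      [forall x in T, x.2 \in A x.1],
      [forall x in T, forall y in T, (p x.1 < p y.1)%O ==> (x.2 <= y.2)%N]
    & [exists f in I, forall x in T, (x.2 <= f (p x.1))%N]].

Lemma rowfulP (T : {set E}) :
  reflect (forall i, exists a, (i, a) \in T) (rowful T).
Proof. by apply: (iffP forallP) => h i; apply/existsP. Qed.

Lemma is_cellP (T : {set E}) :
  reflect [/\ forall i, exists a, (i, a) \in T,
              forall x, x \in T -> x.2 \in A x.1,
              forall x y, x \in T -> y \in T -> (p x.1 < p y.1)%O ->
                (x.2 <= y.2)%N
            & exists2 f, f \in I & forall x, x \in T -> (x.2 <= f (p x.1))%N]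
          (is_cell T).
Proof.
apply: (iffP and4P) => [[/rowfulP h1 /forall_inP h2 /forall_inP h3]|[h1 h2 h3]].
  case/exists_inP => f fI /forall_inP h4; split=> //; last by exists f.
  by move=> x y xT yT; move/forall_inP: (h3 x xT) => /(_ y yT) /implyP.
case=> f fI h4; split; first exact/rowfulP; try exact/forall_inP.
  apply/forall_inP => x xT; apply/forall_inP => y yT; apply/implyP; exact: h3.
by apply/exists_inP; exists f => //; apply/forall_inP.
Qed.

Lemma rowful_up x (T : {set E}) : rowful T -> rowful (x |: T).
Proof.
by move/rowfulP=> h; apply/rowfulP => i; case: (h i) => a aT; exists a;
  rewrite !inE aT orbT.
Qed.

Lemma is_cell_sub (S T : {set E}) : rowful S -> S \subset T -> is_cell T ->
  is_cell S.
Proof.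
move=> /rowfulP rS /subsetP ST /is_cellP [_ h2 h3 [f fI h4]].
apply/is_cellP; split=> // [x /ST /h2//|x y /ST xT /ST yT|]; first exact: h3.
by exists f => // x /ST /h4.
Qed.

(** A choice of one vertex in each row injects the rows into T. *)
Lemma card_rowful (T : {set E}) : rowful T -> (m <= #|T|)%N.
Proof.
move/rowfulP=> /fin_all_exists [a aT].
rewrite -[m in (m <= _)%N]card_ord -cardsT
  -(card_imset _ (f := fun i => (i, a i))) ?subset_leq_card //.
  by apply/subsetP => _ /imsetP[i _ ->].
by move=> i j [].
Qed.

Lemma OmegaBar_inj : injective (@OmegaBar n m).
Proof.
move=> s1 s2 e; apply/ffunP => i; apply/setP => a.
by move/setP: e => /(_ (i, a)); rewrite !inE.
Qed.

Definition rows (T : {set E}) : {ffun 'I_m -> {set 'I_n}} :=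
  [ffun i => [set a | (i, a) \in T]].

Lemma rowsK (T : {set E}) : OmegaBar (rows T) = T.
Proof. by apply/setP => -[i a]; rewrite !inE ffunE inE. Qed.

Lemma card_OmegaBar (s : {ffun 'I_m -> {set 'I_n}}) :
  #|OmegaBar s| = (\sum_i #|s i|)%N.
Proof.
rewrite -sum1_card; under eq_bigl do rewrite inE.
rewrite (eq_bigr (fun i => \sum_(a in s i) 1))%N; last by move=> i _;
  rewrite sum1_card.
by rewrite pair_big_dep.
Qed.

Lemma max_elt_leq (S : {set 'I_n}) k :
  (max_elt S <= k)%N = [forall a in S, (a <= k)%N].
Proof. by apply/bigmax_leqP/forall_inP. Qed.

Lemma leq_min_elt (S : {set 'I_n}) k : S != set0 ->
  (k <= min_elt S)%N = [forall a in S, (k <= a)%N].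
Proof.
case/set0Pn => b bS; apply/idP/forall_inP => [h a aS|h].
  apply: leq_trans h _; rewrite /min_elt.
  elim: (index_enum _) (mem_index_enum a) => // c r IH.
  rewrite inE big_cons => /predU1P[<-|/IH le]; first by rewrite aS geq_minl.
  by case: ifP => // _; rewrite geq_min le orbT.
rewrite /min_elt; elim/big_ind: _ => // [|x y];
  last by rewrite leq_min => -> ->.
by apply: leq_trans (h b bS) _; apply: ltnW.
Qed.

Lemma max_elt_mem (S : {set 'I_n}) : S != set0 ->
  exists2 a, a \in S & max_elt S = a.
Proof. by rewrite -card_gt0 => /eq_bigmax_cond h; case: (h val) => a;
  exists a. Qed.

(** Only the last condition is not a rewording.  If f in I bounds all vertices,
    the map of row maxima lies below f; it is isotone by the order condition on
    rows, so it belongs to I because I is a poset ideal. *)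
Lemma is_symbolE t s :
  is_symbol p A I t s = is_cell (OmegaBar s) && (#|OmegaBar s| == m + t)%N.
Proof.
rewrite /is_symbol card_OmegaBar; case: eqP => _; rewrite /= ?andbF // andbT.
case: p_bij => g pK gK; case: I_ideal => _ /subsetP I_iso I_down.
apply/and3P/is_cellP => [[/forallP h1 h3]|[h1 h2 h3 [f fI h4]]].
  case/exists_inP => f fI /forallP h4; split.
  - by move=> i; case/andP: (h1 i) => /set0Pn [a as_] _; exists a; rewrite inE.
  - by move=> [i a]; rewrite inE /=; case/andP: (h1 i) => _ /subsetP; apply.
  - move=> [i a] [j b]; rewrite !inE /= => asi bsj ij.
    move/'forall_forallP: h3 => /(_ i j); rewrite ij p_num //=.
    rewrite leq_min_elt; last by apply/set0Pn; exists b.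
    move/forall_inP/(_ _ bsj); rewrite max_elt_leq => /forall_inP; exact.
  - exists f => // -[i a]; rewrite inE /= => asi.
    by move: (h4 i) => /eqP ->; apply: leq_bigmax_cond.
have s0 i : s i != set0.
  by case: (h1 i) => a; rewrite inE /= => aS; apply/set0Pn; exists a.
have /fin_all_exists [u uP] i : exists a, a \in s i /\ max_elt (s i) = a.
  by case: (max_elt_mem (s0 i)) => a; exists a.
split.
- apply/forallP => i; rewrite s0; apply/subsetP => a aS.
  by apply: (h2 (i, a)); rewrite inE.
- apply/forallP => i; apply/forallP => j; apply/implyP => /andP[_ ij].
  rewrite leq_min_elt //; apply/forall_inP => b bS.
  rewrite max_elt_leq; apply/forall_inP => a aS.
  by apply: (h3 (i, a) (j, b)); rewrite ?inE.
- apply/exists_inP; exists [ffun q => u (g q)]; last first.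
    by apply/forallP => i; rewrite ffunE pK; case: (uP i) => _ ->.
  have us i : (i, u i) \in OmegaBar s by rewrite inE; case: (uP i).
  apply: (I_down _ f) => //; last first.
    by apply/forallP => q; rewrite ffunE -{2}(gK q); apply: (h4 (_, _)).
  rewrite inE; apply/andP; split; last first.
    by apply/forallP => i; rewrite ffunE pK; apply: (h2 (_, _)).
  apply/forallP => q; apply/forallP => r; apply/implyP; rewrite !ffunE.
  rewrite Order.POrderTheory.le_eqVlt => /predU1P[->//|qr].
  by apply: (h3 (_, _) (_, _)); rewrite ?us //= !gK.
Qed.

(** * Acyclicity of the cells inside a fixed set *)

Section Acyclicity.

Variables (R : comNzRingType) (D : {set E}).

Local Notation bd := (boundary (@var_gt n m) rowful (fun=> 1 : R)).

Definition is_chain (t : nat) (c : {set E} -> R) :=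
  forall T, c T != 0 -> [/\ is_cell T, #|T| = (m + t)%N & T \subset D].

Lemma is_chain_boundary t c : is_chain t.+1 c -> is_chain t (bd c).
Proof.
move=> ct S /boundary_neq0 [rS [x xS /ct [cell_xS card_xS sub_xS]]].
have sub : S \subset x |: S by apply: subsetUr.
split; [exact: is_cell_sub cell_xS| |exact: subset_trans sub sub_xS].
by move: card_xS; rewrite cardsU1 xS addnS => -[].
Qed.

Lemma is_chainB t c1 c2 : is_chain t c1 -> is_chain t c2 ->
  is_chain t (fun T => c1 T - c2 T).
Proof.
move=> ch1 ch2 T; have [->|c1T _] := eqVneq (c1 T) 0; last exact: ch1.
by rewrite sub0r oppr_eq0 => /ch2.
Qed.

Lemma is_chainD t c1 c2 : is_chain t c1 -> is_chain t c2 ->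
  is_chain t (fun T => c1 T + c2 T).
Proof.
move=> ch1 ch2 T; have [->|c1T _] := eqVneq (c1 T) 0; last exact: ch1.
by rewrite add0r => /ch2.
Qed.

(** The pigeonhole principle puts two vertices a and b in one row.  If a third
    vertex could be deleted without emptying a row, then so could a after it,
    leaving fewer vertices than rows. *)
Lemma rowful_card_succ (T : {set E}) : rowful T -> #|T| = m.+1 ->
  exists a b, [/\ a != b, a \in T, b \in T, a.1 = b.1 &
     forall x, (x \in T) && rowful (T :\ x) = (x \in [set a; b])].
Proof.
move=> rT cT.
have : ~ {in T &, injective (fun x : E => x.1)}.
  move=> /card_in_imset e; move: (max_card [in (fun x : E => x.1) @: T]).
  by rewrite e cT card_ord ltnn.
have [/injectiveP|] := boolP (injectiveb (fun x : {x | x \in T} => (val x).1)).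
  move=> inj []; move=> x y xT yT e.
  by have [] := inj (exist _ x xT) (exist _ y yT) e.
case/injectivePn => -[a aT] [[b bT]] /=; rewrite -val_eqE /= => ab e _.
exists a, b; split=> // x; rewrite !inE.
have [xT|xT] /= := boolP (x \in T); last first.
  by apply/esym/negbTE; apply: contra xT => /pred2P[] ->.
apply/idP/idP => [rx|xab]; last first.
  have {xab} [y [yT yx exy]] : exists y, [/\ y \in T, y != x & y.1 = x.1].
    by case/pred2P: xab => ->; [exists b; rewrite eq_sym|exists a].
  apply/rowfulP => i; have [->|ix] := eqVneq i x.1.
    by exists y.2; rewrite -exy -surjective_pairing !inE yx.
  case/rowfulP/(_ i): rT => c cT'; exists c; rewrite !inE cT' andbT.
  by apply: contraNneq ix => <-.
apply/negPn/negP; rewrite negb_or => /andP[xa xb].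
have /card_rowful : rowful (T :\ x :\ a).
  apply/rowfulP => i; case/rowfulP/(_ i): rx => c;
    rewrite !inE => /andP[cx cT'].
  have [ca|ca] := eqVneq (i, c) a; last by exists c; rewrite !inE ca cx.
  exists b.2; rewrite -[i]/((i, c).1) ca e -surjective_pairing !inE bT.
  by rewrite eq_sym ab eq_sym xb.
have := cardsD1 a (T :\ x); have := cardsD1 x T.
by rewrite !inE xT aT [a == x]eq_sym xa cT /= !add1n => -[e1] e2;
  rewrite -ltnS -e2 -e1 ltnn.
Qed.

(** The two admissible faces of an edge have opposite signs, because the
    vertices a and b of the double row are consecutive in the order of T. *)
Lemma sum_faces_edge (T : {set E}) : rowful T -> #|T| = m.+1 ->
  \sum_(x | (x \in T) && rowful (T :\ x))
     (-1) ^+ rank_in (@var_gt n m) x (T :\ x) * 1 = 0 :> R.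
Proof.
move=> rT cT; have [a [b [ab aT bT e h]]] := rowful_card_succ rT cT.
rewrite (eq_bigl _ _ h) (eq_bigl (fun x => (x == a) || (x == b))); last first.
  by move=> x; rewrite !inE.
rewrite (bigD1 a) ?eqxx //= (big_pred1 b) => [|x]; last first.
  by rewrite andb_orl andbN /=; case: (eqVneq x b) => [->|]; rewrite // eq_sym.
pose V := T :\ a :\ b.
have TaE : T :\ a = b |: V by rewrite /V setD1K // !inE eq_sym ab.
have TbE : T :\ b = a |: V by rewrite /V setDDl [[set a] :|: [set b]]setUC
  -setDDl setD1K // !inE ab.
rewrite TaE TbE !rank_inU1 ?inE ?eqxx ?andbF //.
(* The other vertices lie in other rows and do not separate a from b. *)
have -> : rank_in (@var_gt n m) b V = rank_in (@var_gt n m) a V.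
  rewrite /rank_in; congr #|pred_of_set _|; apply/setP => y; rewrite !inE.
  case: (boolP [&& y != b, y != a & y \in T]) => //= /and3P[yb ya yT].
  have : ~~ ((y \in T) && rowful (T :\ y)) by rewrite h !inE negb_or ya.
  rewrite yT /= => nr; have ya1 : y.1 != a.1.
    apply: contra nr => /eqP ya1; apply/rowfulP => i.
    case/rowfulP/(_ i): (rT) => c cT'; have [cy|cy] := eqVneq (i, c) y;
      last first.
      by exists c; rewrite !inE cy.
    by exists a.2; rewrite -[i]/((i, c).1) cy ya1 -surjective_pairing !inE
      eq_sym ya.
  by rewrite /var_gt -e (negPf ya1) !orbF.
rewrite (var_gt_asym ab); case: (var_gt b a); rewrite /= ?add0n ?add1n exprS;
  ring.
Qed.

Lemma sum_boundary1 c : is_chain 1 c -> \sum_S bd c S = 0.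
Proof.
move=> ch; rewrite sum_boundary big1 // => T _.
have [->|/ch [/and4P[rT _ _ _] cT _]] := eqVneq (c T) 0; first by rewrite mul0r.
by rewrite sum_faces_edge ?mulr0 // cT addn1.
Qed.

(** Minimality is over all cells inside D at once, which makes i -> a_i an
    isotone map: if p_j < p_i, a cell containing (i, a_i) has some (j, d), and
    a_j <= d <= a_i. *)
Definition least_vertex (i : 'I_m) (a : 'I_n) :=
  (exists T, [/\ is_cell T, T \subset D & (i, a) \in T]) /\
  (forall T b, is_cell T -> T \subset D -> (i, b) \in T -> (a <= b)%N).

Lemma least_vertexP T : is_cell T -> T \subset D ->
  exists a : 'I_m -> 'I_n, forall i, least_vertex i (a i).
Proof.
move=> cT TD; apply: fin_all_exists => i.
case/is_cellP: (cT) => /(_ i) [b bT] _ _ _.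
pose W := [pred b |
  [exists S : {set E}, [&& is_cell S, S \subset D & (i, b) \in S]]].
have Wb : W b by apply/existsP; exists T; rewrite cT TD.
case: (arg_minnP (fun b : 'I_n => nat_of_ord b) Wb) =>
  a /existsP[S /and3P[cS SD aS]] amin.
exists a; split; first by exists S.
by move=> S' b' cS' SD' bS'; apply: amin; apply/existsP; exists S';
  rewrite cS' SD'.
Qed.

(** The stage of the collapse after rows 0, ..., k - 1 have been treated. *)
Definition pinned_below (a : 'I_m -> 'I_n) (k : nat) (T : {set E}) :=
  forall (j : 'I_m) b, (j < k)%N -> (j, b) \in T -> b = a j.

(** An earlier row j has only the vertex a_j, which is at most a_i when
    p_j < p_i; for a later row, and for the bound by a member of I, (i, a_i) is
    dominated by the vertices already present in row i. *)
Lemma is_cell_insert a (i : 'I_m) T : (forall i, least_vertex i (a i)) ->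
  is_cell T -> T \subset D -> pinned_below a i T ->
  is_cell ((i, a i) |: T) /\ (i, a i) |: T \subset D.
Proof.
move=> la cT TD st; case: (la i) => -[S [cS SD aS]] amin.
have low b : (i, b) \in T -> (a i <= b)%N by apply: amin.
split; last by rewrite subUset TD sub1set (subsetP SD).
case/is_cellP: (cS) => _ hA _ _; have aA := hA _ aS.
case/is_cellP: (cT) => h1 h2 h3 [f fI h4].
apply/is_cellP; split.
- by move=> j; case: (h1 j) => b bT; exists b; rewrite !inE bT orbT.
- by move=> x /setU1P[->|/h2].
- move=> [j b] [l c] /setU1P[[-> ->]|jT] /setU1P[[-> ->]|lT] //=.
  + move=> il; case: (h1 i) => d dT; apply: leq_trans (low _ dT) _.
    exact: (h3 _ _ dT lT).
  + move=> ji; rewrite (st j b) ?p_num //.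
    case/is_cellP: (cS) => hS _ hS3 _; case: (hS j) => d dS.
    case: (la j) => _ /(_ S d cS SD dS) ad.
    exact: leq_trans ad (hS3 _ _ dS aS ji).
  + exact: (h3 _ _ jT lT).
- exists f => // x /setU1P[->|/h4 //] /=; case: (h1 i) => d dT.
  exact: leq_trans (low _ dT) (h4 _ dT).
Qed.

(** Induction on the number of rows still to be treated.  Subtracting the
    boundary of the cone with vertex (k, a_k) keeps the class of the cycle and
    pins row k. *)
Lemma chain_exact_below a t k c : (forall i, least_vertex i (a i)) ->
  (k <= m)%N -> is_chain t c -> (forall T, c T != 0 -> pinned_below a k T) ->
  (forall S, bd c S = 0) -> (t = 0%N -> \sum_T c T = 0) ->
  exists2 h, is_chain t.+1 h & forall S, bd h S = c S.
Proof.
move=> la km; have [l ml] : exists l, (l + k = m)%N by exists (m - k)%N;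
  rewrite subnK.
elim: l k km ml c => [|l IH] k km ml c ch st cyc aug.
  exists (fun=> 0) => [T|S]; first by rewrite eqxx.
  have -> : bd (fun=> 0) S = 0.
    rewrite /boundary; case: ifP => // _; apply: big1 => x _; exact: mulr0.
  (* All rows are pinned, so T0 is the only cell that can carry c. *)
  pose T0 := [set (i, a i) | i : 'I_m].
  have cT0 T : c T != 0 -> T = T0.
    move=> cT; have [cell_T _ _] := ch T cT.
    have aT i b : (i, b) \in T -> b = a i by apply: (st T cT);
      apply: (leq_trans (ltn_ord i)); rewrite -ml.
    apply/setP => -[i b]; apply/idP/imsetP => [/aT ->|[j _ [-> ->]]];
      first by exists i.
    by case/is_cellP: cell_T => /(_ j) [d dT] _ _ _; rewrite -(aT _ _ dT).
  apply/esym/eqP/negPn/negP => cS; have ST0 := cT0 _ cS.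
  have t0 : t = 0%N.
    have [_ /eqP] := ch S cS; rewrite ST0 card_imset => [|i j [] //].
    by rewrite card_ord -[X in X == _]addn0 eqn_add2l => /eqP.
  case/eqP: cS; rewrite -(aug t0) (bigD1 S) //= big1 ?addr0 // => T TS.
  by apply/eqP/negPn/negP => /cT0 TT0; rewrite TT0 ST0 eqxx in TS.
have km' : (k < m)%N by rewrite -ml addSn ltnS leq_addl.
pose i := Ordinal km'.
pose h0 := cone (@var_gt n m) (i, a i) c.
have h0ch : is_chain t.+1 h0.
  move=> T; rewrite /h0 /cone; case: ifP => [aT|_]; last by rewrite eqxx.
  have [->|cT _] := eqVneq (c (T :\ (i, a i))) 0; first by rewrite mulr0 eqxx.
  have [cell_T card_T T_D] := ch _ cT.
  have [] := is_cell_insert (i := i) la cell_T T_D (st _ cT);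
    rewrite setD1K // => cellT TD.
  by split=> //; rewrite (cardsD1 (i, a i)) aT card_T addnS.
(* By the cone identities, c - bd h0 lives on the S containing (i, a i) for
   which deleting this vertex empties a row, that is, with i-th row {a i}. *)
have bd_h0 S : c S - bd h0 S != 0 -> pinned_below a k.+1 S.
  move=> cS.
  have [rS stS] : rowful S /\ pinned_below a k S.
    have [c0|/[dup] cS0 /st stS] := eqVneq (c S) 0; last first.
      by split=> //; case/ch: cS0 => /and4P[].
    move: cS; rewrite c0 sub0r oppr_eq0 => /boundary_neq0[rS [x xS]].
    rewrite /h0 /cone; case: ifP => [_|]; last by rewrite eqxx.
    have [->|cxS _] := eqVneq (c ((x |: S) :\ (i, a i))) 0;
      first by rewrite mulr0 eqxx.
    split=> // j b jk bS; apply: (st _ cxS j b jk); rewrite !inE bS orbT andbT.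
    by rewrite xpair_eqE negb_and -val_eqE /= neq_ltn jk.
  have {cS} rS1 : (i, a i) \in S /\ ~~ rowful (S :\ (i, a i)).
    have [aS|aS] := boolP ((i, a i) \in S); last first.
      have := boundary_cone_notin (@var_gt n m) c (w := fun=> 1) erefl rS aS.
      by rewrite -/h0 => e; rewrite e subrr eqxx in cS.
    split=> //; apply/negP => rS1.
    have := boundary_cone_in (@var_gt_asym n m) rowful_up (w := fun=> 1) erefl
      rS1 aS (cyc _).
    by rewrite -/h0 => e; rewrite e subrr eqxx in cS.
  move=> j b; rewrite ltnS leq_eqVlt => /predU1P[jk|jk bS]; last exact: stS.
  have -> : j = i by apply: val_inj.
  move=> bS; apply/eqP/negPn/negP => ba; case: rS1 => aS /negP[].
  apply/rowfulP => r; have [->|ri] := eqVneq r i.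
    by exists b; rewrite !inE xpair_eqE eqxx bS ba.
  by case/rowfulP/(_ r): rS => d dS; exists d;
    rewrite !inE xpair_eqE (negPf ri) dS.
have [||||||h' h'ch h'E] := IH k.+1 _ _ (fun S => c S - bd h0 S).
- by [].
- by rewrite addnS -addSn.
- exact: is_chainB ch (is_chain_boundary h0ch).
- exact: bd_h0.
- move=> S; rewrite boundaryB cyc (boundary_boundary (@var_gt_asym n m)) ?subrr
  //.
  exact: rowful_up.
- move=> t0; rewrite sumrB aug // sum_boundary1 ?subrr //.
  by rewrite t0 in h0ch.
exists (fun T => h0 T + h' T); first exact: is_chainD.
by move=> S; rewrite boundaryD h'E addrC subrK.
Qed.

(** The reduced homology of the cells inside D vanishes: in degree 0 a cycle is
    a chain whose coefficients sum to zero. *)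
Lemma chain_exact t c : is_chain t c ->
  (forall S, bd c S = 0) -> (t = 0%N -> \sum_T c T = 0) ->
  exists2 h, is_chain t.+1 h & forall S, bd h S = c S.
Proof.
move=> ch cyc aug; have [T cT|c0] := pickP (fun T => c T != 0).
  have [cell_T _ TD] := ch T cT; have [a la] := least_vertexP cell_T TD.
  by apply: (@chain_exact_below a t 0).
exists c => [T|S]; first by rewrite c0.
by rewrite cyc; apply/esym/eqP/negPn; rewrite c0.
Qed.

End Acyclicity.
End Cells.

(** * Multigraded strands *)

Lemma mcoeffMXE (R : nzRingType) N (q : {mpoly R[N]}) (u k : 'X_{1..N}) :
  (q * 'X_[u])@_k = if (u <= k)%MM then q@_(k - u) else 0.
Proof.
case: ifP => [uk|nuk]; first by rewrite -{1}(submK uk) addmC mcoeffMX.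
apply: memN_msupp_eq0; rewrite (perm_mem (msuppMX _ _)).
by apply/mapP => -[u' _ kE]; rewrite kE lem_addr in nuk.
Qed.

Lemma mcoeff_sign (R : nzRingType) N r (q : {mpoly R[N]}) (k : 'X_{1..N}) :
  ((-1) ^+ r * q)@_k = (-1) ^+ r * q@_k.
Proof. by rewrite -signr_odd -(signr_odd R); case: (odd r);
  rewrite /= ?expr1 ?expr0 ?mulN1r ?mul1r ?mcoeffN. Qed.

Section Strands.

Variables (n : nat) (disp : Order.disp_t) (P : finPOrderType disp) (m : nat).
Variables (p : 'I_m -> P).
Hypothesis p_bij : bijective p.
Variable K : fieldType.

Local Notation E := ('I_m * 'I_n)%type.
Local Notation N := (nvars P n).

Definition vertex_var (x : E) : 'I_N := var (p x.1) x.2.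

Lemma vertex_var_inj : injective vertex_var.
Proof.
by move=> [i a] [j b] /enum_rank_inj [/(bij_inj p_bij) /= -> ->].
Qed.

Lemma vertex_var_surj i : exists x, vertex_var x = i.
Proof.
case: p_bij => g _ gK; rewrite -(enum_valK i); case: (enum_val i) => q a.
by exists (g q, a); rewrite /vertex_var /= gK.
Qed.

Definition cell_mdeg (T : {set E}) : 'X_{1..N} :=
  (\sum_(x in T) U_(vertex_var x))%MM.

Lemma cell_mdegE (T : {set E}) x : cell_mdeg T (vertex_var x) = (x \in T).
Proof.
rewrite mnm_sumE; under eq_bigr do rewrite mnm1E (inj_eq vertex_var_inj).
case: (boolP (x \in T)) => xT; last first.
  by rewrite big1 // => y yT; case: eqVneq => // yx; rewrite -yx yT in xT.
by rewrite (bigD1 x) //= eqxx big1 ?addn0 // => y /andP[_ /negPf ->].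
Qed.

Lemma cell_mdegU1 x (T : {set E}) : x \notin T ->
  cell_mdeg (x |: T) = (U_(vertex_var x) + cell_mdeg T)%MM.
Proof. exact: big_setU1. Qed.

Definition msupport (alpha : 'X_{1..N}) : {set E} :=
  [set x | alpha (vertex_var x) != 0%N].

(** Multidegrees of cells are squarefree, so divisibility only depends on the
    support of alpha. *)
Lemma cell_mdeg_le T alpha : (cell_mdeg T <= alpha)%MM =
  (T \subset msupport alpha).
Proof.
apply/mnm_lepP/subsetP => [h x xT|h i].
  by have := h (vertex_var x); rewrite cell_mdegE xT inE lt0n.
have [x <-] := vertex_var_surj i; rewrite cell_mdegE;
  case: (boolP (x \in T)) => // /h.
by rewrite inE lt0n.
Qed.

(** The component of multidegree alpha of a polynomial chain, where T has
    multidegree [cell_mdeg T]; it is determined by one scalar for each T. *)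
Definition strand (alpha : 'X_{1..N}) (c : {set E} -> {mpoly K[N]})
  (T : {set E}) : K :=
  if (cell_mdeg T <= alpha)%MM then (c T)@_(alpha - cell_mdeg T) else 0.

Lemma strand_inj c1 c2 : (forall alpha, strand alpha c1 =1 strand alpha c2) ->
  c1 =1 c2.
Proof.
move=> h T; apply/mpolyP => u; have := h (u + cell_mdeg T)%MM T.
by rewrite /strand lem_addl addmK.
Qed.

Local Notation bdX := (boundary (@var_gt n m) (@rowful n m)
  (fun x => 'X_(vertex_var x) : {mpoly K[N]})).
Local Notation bd1 := (boundary (@var_gt n m) (@rowful n m) (fun=> 1 : K)).

(** Multiplying by the variable of x shifts the coefficient by exactly the
    amount by which adding x raises the multidegree of T. *)
Lemma strand_boundary alpha c : strand alpha (bdX c) =1 bd1 (strand alpha c).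
Proof.
move=> T; have strandE c' : strand alpha c' T =
  if (cell_mdeg T <= alpha)%MM then (c' T)@_(alpha - cell_mdeg T) else 0 by [].
rewrite {}strandE /boundary.
have [rT|_] := boolP (rowful T); last by rewrite mcoeff0 if_same.
have [le|nle] := boolP (cell_mdeg T <= alpha)%MM; last first.
  apply/esym; apply: big1 => x xT; rewrite /strand ifN ?mulr0 // cell_mdegU1 //.
  by apply: contra nle; apply: lepm_trans; apply: lem_addl.
rewrite raddf_sum /=; apply: eq_bigr => x xT.
rewrite -mulrA mcoeff_sign mulr1 ['X_(_) * _]mulrC mcoeffMXE /strand cell_mdegU1
  //.
rewrite submDA [(cell_mdeg T + _)%MM]addmC.
suff -> : (U_(vertex_var x) <= alpha - cell_mdeg T)%MM =
  (U_(vertex_var x) + cell_mdeg T <= alpha)%MM by [].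
by apply/mnm_lepP/mnm_lepP => h i; move: (h i) (mnm_lepP le i);
  rewrite mnmDE mnmBE; lia.
Qed.

(** Inverse construction to taking strands: the polynomial chain whose strand
    of multidegree alpha is h alpha, for alpha in r, and 0 otherwise. *)
Definition strand_sum (r : seq 'X_{1..N}) (h : 'X_{1..N} -> {set E} -> K)
  (T : {set E}) : {mpoly K[N]} :=
  \sum_(alpha <- r) h alpha T *: 'X_[alpha - cell_mdeg T].

Lemma strand_strand_sum r h beta T : uniq r ->
  (forall alpha (T : {set E}), h alpha T != 0 -> T \subset msupport alpha) ->
  strand beta (strand_sum r h) T = if beta \in r then h beta T else 0.
Proof.
move=> ur hD; rewrite /strand; case: ifP => [le|nle]; last first.
  case: ifP => // _; apply/esym/eqP/negPn/negP => /hD.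
  by rewrite -cell_mdeg_le nle.
rewrite raddf_sum /=.
transitivity (\sum_(alpha <- r) if alpha == beta then h beta T else 0).
  apply: eq_bigr => alpha _; rewrite mcoeffZ mcoeffX.
  have [->|ab] := eqVneq alpha beta; first by rewrite eqxx mulr1.
  have [->|/hD] := eqVneq (h alpha T) 0; first by rewrite mul0r.
  rewrite -cell_mdeg_le => le'; rewrite (_ : (_ == _) = false) ?mulr0 //.
  apply: contraNF ab => /eqP e; rewrite -(submK le') -(submK le) e //.
case: ifP => [br|/negbT br].
  by rewrite (bigD1_seq beta) //= eqxx big1 ?addr0 // => i /negPf ->.
rewrite big_seq big1 // => i ir; case: eqVneq => // ib; by rewrite -ib ir in br.
Qed.

Definition strand_degrees (c : {set E} -> {mpoly K[N]}) : seq 'X_{1..N} :=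
  undup (flatten [seq [seq (u + cell_mdeg T)%MM | u <- msupp (c T)] | T :
    {set E}]).

Lemma strand_notin_degrees c alpha T : alpha \notin strand_degrees c ->
  strand alpha c T = 0.
Proof.
move=> h; rewrite /strand; case: ifP => // le; apply: memN_msupp_eq0.
apply: contra h => us; rewrite mem_undup; apply/flatten_mapP; exists T;
  first by rewrite mem_enum.
by apply/mapP; exists (alpha - cell_mdeg T)%MM => //; rewrite submK.
Qed.

End Strands.

(** * The complex of symbols *)

Section Complex.

Variables (n : nat) (disp : Order.disp_t) (P : finPOrderType disp) (m : nat).
Variables (p : 'I_m -> P) (A : 'I_m -> {set 'I_n}).
Variable I : {set {ffun P -> 'I_n}}.
Variable K : fieldType.

Local Notation E := ('I_m * 'I_n)%type.
Local Notation N := (nvars P n).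
Local Notation F := (symbol_module K p A I).
Local Notation bdX := (boundary (@var_gt n m) (@rowful n m)
  (fun x => 'X_(vertex_var p x) : {mpoly K[N]})).
Local Notation bd1 := (boundary (@var_gt n m) (@rowful n m) (fun=> 1 : K)).

(** Extension by zero from symbols of degree t to all subsets of the grid, so
    that the differentials of all degrees become one operator on chains. *)
Definition chain_of t (c : F t) (T : {set E}) : {mpoly K[N]} :=
  \sum_(s | OmegaBar (val s) == T) (c s : {mpoly K[N]}).

Lemma chain_ofE t (c : F t) s : chain_of c (OmegaBar (val s)) = c s.
Proof.
by rewrite /chain_of (big_pred1 s) // => s';
  rewrite /= (inj_eq (@OmegaBar_inj _ _)).
Qed.

Lemma chain_of_linear t a (c1 c2 : F t) T :
  chain_of (a *: c1 + c2) T = a * chain_of c1 T + chain_of c2 T.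
Proof.
by rewrite /chain_of mulr_sumr -big_split; apply: eq_bigr => s _;
  rewrite !ffunE.
Qed.

Definition diff t (c : F t.+1) : F t :=
  [ffun s => bdX (chain_of c) (OmegaBar (val s))].

Lemma diff_is_linear t : linear (@diff t).
Proof.
move=> a c1 c2; apply/ffunP => s; rewrite !ffunE /boundary.
case: ifP => _; last by rewrite scaler0 addr0.
rewrite scaler_sumr -big_split; apply: eq_bigr => x _.
by rewrite chain_of_linear mulrDr /= /GRing.scale /= mulrCA.
Qed.

HB.instance Definition _ t :=
  GRing.isLinear.Build {mpoly K[N]} (F t.+1) (F t) _ (@diff t)
    (@diff_is_linear t).

Definition aug (c : F 0) : {mpoly K[N]}^o :=
  \sum_s (c s : {mpoly K[N]}) * 'X_[cell_mdeg p (OmegaBar (val s))].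

Lemma aug_is_linear : linear aug.
Proof.
move=> a c1 c2; rewrite /aug scaler_sumr -big_split; apply: eq_bigr => s _.
by rewrite !ffunE mulrDl /= /GRing.scale /= mulrA.
Qed.

HB.instance Definition _ :=
  GRing.isLinear.Build {mpoly K[N]} (F 0) {mpoly K[N]}^o _ aug aug_is_linear.

End Complex.

(** * Exactness *)

Section IdealGen.

Variables (R : comNzRingType) (J : finType) (S : {set J}) (g : J -> R).

Lemma ideal_gen0 : ideal_gen S g 0.
Proof. by exists (fun=> 0); rewrite big1 // => j _; rewrite mul0r. Qed.

Lemma ideal_genD x y : ideal_gen S g x -> ideal_gen S g y ->
  ideal_gen S g (x + y).
Proof.
move=> [c ->] [d ->]; exists (fun j => c j + d j); rewrite -big_split.
by apply: eq_bigr => j _; rewrite mulrDl.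
Qed.

Lemma ideal_gen_mul a j : j \in S -> ideal_gen S g (a * g j).
Proof.
move=> jS; exists (fun i => if i == j then a else 0).
rewrite (bigD1 j) //= eqxx big1 ?addr0 // => i /andP[_ /negPf ->]; exact: mul0r.
Qed.

End IdealGen.

Section Resolution.

Variables (n : nat) (disp : Order.disp_t) (P : finPOrderType disp) (m : nat).
Variables (p : 'I_m -> P) (A : 'I_m -> {set 'I_n}).
Variable I : {set {ffun P -> 'I_n}}.
Variable K : fieldType.
Hypothesis p_bij : bijective p.
Hypothesis p_num : forall i j : 'I_m, (p i < p j)%O -> (i < j)%N.
Hypothesis I_ideal : poset_ideal (@le_map disp P n) (isotone_maps p A) I.

Local Notation E := ('I_m * 'I_n)%type.
Local Notation N := (nvars P n).
Local Notation F := (symbol_module K p A I).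
Local Notation bdX := (boundary (@var_gt n m) (@rowful n m)
  (fun x => 'X_(vertex_var p x) : {mpoly K[N]})).
Local Notation bd1 := (boundary (@var_gt n m) (@rowful n m) (fun=> 1 : K)).

Lemma symbolP t (s : symbol p A I t) :
  is_cell p A I (OmegaBar (val s)) /\ #|OmegaBar (val s)| = (m + t)%N.
Proof. by have := valP s; rewrite is_symbolE // => /andP[? /eqP]. Qed.

Lemma symbol_of_cell t (T : {set E}) : is_cell p A I T -> #|T| = (m + t)%N ->
  exists s : symbol p A I t, OmegaBar (val s) = T.
Proof.
move=> cT /eqP kT.
have sT : is_symbol p A I t (rows T) by rewrite is_symbolE ?rowsK ?cT.
by exists (exist _ (rows T) sT); rewrite /= rowsK.
Qed.

Lemma chain_of_support t (c : F t) T : chain_of c T != 0 ->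
  is_cell p A I T /\ #|T| = (m + t)%N.
Proof.
rewrite /chain_of => cT; have [s /eqP <-|none] :=
    pickP (fun s : symbol p A I t => OmegaBar (val s) == T).
  exact: symbolP.
by rewrite big_pred0 ?eqxx in cT.
Qed.

Lemma strand_is_chain t (c : F t) alpha :
  is_chain p A I (msupport p alpha) t (strand p alpha (chain_of c)).
Proof.
move=> T; rewrite /strand; case: ifP => [le cT|]; last by rewrite eqxx.
have [|cell_T card_T] := @chain_of_support t c T; last by rewrite -cell_mdeg_le.
by apply: contraNneq cT => ->; rewrite mcoeff0.
Qed.

Definition of_chain t (c : {set E} -> {mpoly K[N]}) : F t :=
  [ffun s => c (OmegaBar (val s))].

Lemma of_chainK t (c : {set E} -> {mpoly K[N]}) :
  (forall T, c T != 0 -> is_cell p A I T /\ #|T| = (m + t)%N) ->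
  chain_of (of_chain t c) =1 c.
Proof.
move=> h T; rewrite /chain_of.
under eq_bigr => s /eqP sT do rewrite ffunE sT.
have [->|/h [cT kT]] := eqVneq (c T) 0; first by rewrite big1.
have [s0 sT] := symbol_of_cell cT kT.
by rewrite (big_pred1 s0) // => s; rewrite -sT /= (inj_eq (@OmegaBar_inj _ _)).
Qed.

Lemma chain_of_diff t (c : F t.+1) : chain_of (diff c) =1 bdX (chain_of c).
Proof.
apply: of_chainK => T /boundary_neq0 [rT [x xT /chain_of_support [cT kT]]].
split; first by apply: is_cell_sub cT => //; apply: subsetUr.
by move: kT; rewrite cardsU1 xT addnS => -[].
Qed.

Lemma diff_diff t (c : F t.+2) : diff (diff c) = 0.
Proof.
apply/ffunP => s; rewrite !ffunE (eq_boundary _ _ _ (chain_of_diff c)).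
exact: (boundary_boundary (@var_gt_asym n m) (@rowful_up n m)).
Qed.

(** On strands, d_0 becomes the sum of coefficients. *)
Lemma mcoeff_aug (c : F 0) alpha :
  (aug c : {mpoly K[N]})@_alpha = \sum_T strand p alpha (chain_of c) T.
Proof.
rewrite /aug raddf_sum /=
  (bigID (fun T => [exists s : symbol p A I 0, OmegaBar (val s) == T])) /=.
rewrite [X in _ = _ + X]big1 ?addr0 => [|T /existsPn h]; last first.
  rewrite /strand; case: ifP => // _;
    rewrite /chain_of big_pred0 ?mcoeff0 // => s.
  exact: negbTE (h s).
transitivity (\sum_(T in [set OmegaBar (val s) | s : symbol p A I 0]) strand p
  alpha (chain_of c) T); last first.
  apply: eq_bigl => T; apply/imsetP/existsP => [[s _ ->]|[s /eqP <-]];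
    by exists s.
rewrite big_imset /=; last by move=> s1 s2 _ _ /OmegaBar_inj /val_inj.
by apply: eq_bigr => s _; rewrite mcoeffMXE /strand chain_ofE.
Qed.

Lemma aug_diff (c : F 1) : aug (diff c) = 0.
Proof.
apply/mpolyP => alpha; rewrite mcoeff_aug mcoeff0.
rewrite -[RHS](sum_boundary1 (@strand_is_chain 1 c alpha)).
apply: eq_bigr => T _; rewrite -strand_boundary // /strand.
by case: ifP; rewrite ?chain_of_diff.
Qed.

(** Each strand of c bounds by [chain_exact]; the finitely many strands that
    are not zero are assembled into one polynomial chain with boundary c. *)
Lemma diff_exact t (c : F t) : (forall S, bdX (chain_of c) S = 0) ->
  (t = 0%N -> forall alpha, \sum_T strand p alpha (chain_of c) T = 0) ->
  exists y : F t.+1, diff y = c.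
Proof.
move=> cyc augc.
have ex alpha : exists h : {set E} -> K,
    is_chain p A I (msupport p alpha) t.+1 h /\
    forall S, bd1 h S = strand p alpha (chain_of c) S.
  have [| |h hch hE] := chain_exact p_num (@strand_is_chain t c alpha);
    last by exists h.
    by move=> S; rewrite -strand_boundary // /strand cyc mcoeff0 if_same.
  by move=> t0; apply: augc.
pose h alpha := proj1_sig (constructive_indefinite_description _ (ex alpha)).
have hP alpha : is_chain p A I (msupport p alpha) t.+1 (h alpha) /\
    forall S, bd1 (h alpha) S = strand p alpha (chain_of c) S.
  exact: proj2_sig (constructive_indefinite_description _ (ex alpha)).
pose r := strand_degrees p (chain_of c).
pose y := strand_sum p r h.
have hD alpha T : h alpha T != 0 -> T \subset msupport p alpha.
  by case: (hP alpha) => ch _ /ch [].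
have yK : chain_of (of_chain t.+1 y) =1 y.
  apply: of_chainK => T yT.
  have [alpha hT] : exists alpha, h alpha T != 0.
    have [/hasP[alpha _ ?]|/hasPn none] :=
      boolP (has (fun alpha => h alpha T != 0) r).
      by exists alpha.
    case/eqP: yT; rewrite /y /strand_sum big_seq big1 // => alpha /none.
    by rewrite negbK => /eqP ->; rewrite scale0r.
  by case: (hP alpha) => /(_ T hT) [].
exists (of_chain t.+1 y); apply/ffunP => s; rewrite ffunE -[RHS]chain_ofE.
move: (OmegaBar (val s)); apply: (strand_inj (p := p)) => beta T.
rewrite strand_boundary.
have e : strand p beta (chain_of (of_chain t.+1 y)) =1
    fun T => if beta \in r then h beta T else 0.
  move=> S; transitivity (strand p beta y S); first by rewrite /strand yK.
  exact: (strand_strand_sum p_bij beta S (undup_uniq _) hD).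
rewrite (eq_boundary _ _ _ e).
have [br|br] := boolP (beta \in r); first by case: (hP beta).
rewrite strand_notin_degrees // /boundary; case: ifP => // _.
by apply: big1 => x _; rewrite mulr0.
Qed.

Lemma is_symbol_map f : f \in I ->
  is_symbol p A I 0 [ffun i => [set f (p i)]].
Proof.
case: I_ideal => _ /subsetP h _ fI; have := h f fI;
  rewrite inE => /andP[/forallP iso /forallP fA].
have T_E x : (x \in OmegaBar [ffun i => [set f (p i)]]) = (x.2 == f (p x.1)).
  by rewrite inE ffunE inE.
rewrite is_symbolE //; apply/andP; split.
  apply/is_cellP; split.
  - by move=> i; exists (f (p i)); rewrite T_E.
  - by move=> x; rewrite T_E => /eqP ->.
  - move=> x y; rewrite !T_E => /eqP -> /eqP -> xy.
    by move/forallP: (iso (p x.1)) => /(_ (p y.1)) /implyP; apply;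
      apply: Order.POrderTheory.ltW.
  - by exists f => // x; rewrite T_E => /eqP ->.
by rewrite card_OmegaBar; under eq_bigr do rewrite ffunE cards1;
  rewrite sum1_card card_ord addn0.
Qed.

(** In degree 0 the m rows are non-empty and have m elements altogether, so
    they are singletons. *)
Lemma is_symbol0_map (s : {ffun 'I_m -> {set 'I_n}}) : is_symbol p A I 0 s ->
  exists2 f, f \in I & s = [ffun i => [set f (p i)]].
Proof.
rewrite /is_symbol addn0 =>
  /and4P[/forallP s0 /eqP cs _ /exists_inP[f fI /forallP fmax]].
exists f => //; apply/ffunP => i; rewrite ffunE.
have /eqP/cards1P [a sa] : #|s i| = 1%N.
  have le1 j : (1 <= #|s j|)%N by rewrite card_gt0; case/andP: (s0 j).
  have e : (\sum_(j < m) 1)%N =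
    (\sum_j #|s j|)%N by rewrite sum1_card card_ord cs.
  apply/eqP; rewrite eqn_leq le1 andbT leqNgt; apply/negP => gt1.
  have : (\sum_(j < m) 1 < \sum_j #|s j|)%N.
    by rewrite [ltnLHS](bigD1 i) // [ltnRHS](bigD1 i) //= -addSn leq_add //
      leq_sum.
  by rewrite e ltnn.
have := fmax i; rewrite sa /max_elt big_set1 => /eqP e.
by congr [set _]; apply/esym/val_inj.
Qed.

Lemma Umon_mdeg f :
  Umon K f = 'X_[cell_mdeg p (OmegaBar [ffun i => [set f (p i)]])] :>
    {mpoly K[N]}.
Proof.
case: p_bij => g pK gK.
rewrite /Umon /cell_mdeg -mprodXE [LHS](reindex p) /=; last by exists g => ? _.
transitivity (\prod_i \prod_(a in [set f (p i)]) 'X_(vertex_var p (i, a)) :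
  {mpoly K[N]}).
  by apply: eq_bigr => i _; rewrite big_set1.
rewrite pair_big_dep; apply: eq_big => [[i a]|[i a] _ //].
by rewrite !inE ffunE inE.
Qed.

Lemma aug_basis (s : symbol p A I 0) :
  aug (basis_vector {mpoly K[N]} s) = 'X_[cell_mdeg p (OmegaBar (val s))].
Proof.
rewrite /aug (bigD1 s) //= big1 ?addr0 => [|s' /negPf s's].
  by rewrite ffunE eqxx mul1r.
by rewrite ffunE s's mul0r.
Qed.

Lemma aug_image (y : {mpoly K[N]}) :
  coletterplace K I y <-> exists x : F 0, aug x = y.
Proof.
split=> [[c ->]|[x <-]].
  apply: (big_ind (fun y => exists x : F 0, aug x = y)) =>
    [|_ _ [x1 <-] [x2 <-]|f fI].
  - by exists 0; rewrite raddf0.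
  - by exists (x1 + x2); rewrite raddfD.
  pose s : symbol p A I 0 := exist (is_symbol p A I 0) _ (is_symbol_map fI).
  by exists (c f *: basis_vector _ s); rewrite linearZ /= aug_basis Umon_mdeg.
apply: (big_ind (coletterplace K I)) => [| |s _];
  [exact: ideal_gen0|exact: ideal_genD|].
case: (is_symbol0_map (valP s)) => f fI ->; rewrite -Umon_mdeg.
exact: (ideal_gen_mul (@Umon K disp P n)).
Qed.

End Resolution.

(** * Length of projective resolutions *)

(** The steps carry consecutive pairs (f t, f t.+1), because the relation needed
    to go on is between two consecutive terms. *)
Lemma dependent_choice_nat (X : nat -> Type)
  (rel : forall t, X t -> X t.+1 -> Prop) :
  (forall t x y, rel t x y -> exists z, rel t.+1 y z) ->
  forall x0 x1, rel 0 x0 x1 ->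
  exists f : forall t, X t, f 0 = x0 /\ forall t, rel t (f t) (f t.+1).
Proof.
move=> step x0 x1 r0.
pose S t := {xy : X t * X t.+1 | rel t xy.1 xy.2}.
pose next t (s : S t) : S t.+1 :=
  let w := constructive_indefinite_description _ (step t _ _ (proj2_sig s)) in
  exist (fun xy => rel t.+1 xy.1 xy.2) ((proj1_sig s).2, proj1_sig w)
    (proj2_sig w).
pose chain := fix chain t : S t :=
  if t is t'.+1 return S t then next t' (chain t') else exist _ (x0, x1) r0.
by exists (fun t => (proj1_sig (chain t)).1); split=> // t;
  apply: (proj2_sig (chain t)).
Qed.

Section Modules.

Variable R : comNzRingType.

Definition linear_of (U V : lmodType R) (f : U -> V) (lf : linear f) :
  {linear U -> V} := HB.pack f (GRing.isLinear.Build R U V _ f lf).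

(** The kernel as a module of its own, used below to form pullbacks. *)
Section Kernel.

Variables (U V : lmodType R) (f : {linear U -> V}).

Definition kernel : {pred U} := fun u => f u == 0.

Fact kernel_submod_closed : submod_closed kernel.
Proof.
split=> [|a u v]; rewrite !unfold_in /=; first by rewrite linear0.
by move=> /eqP fu /eqP fv; rewrite linearP fu fv scaler0 addr0.
Qed.

HB.instance Definition _ :=
  GRing.isSubmodClosed.Build R U kernel kernel_submod_closed.

Record kernel_module :=
  KernelElement {kernel_val : U; _ : kernel_val \in kernel}.

HB.instance Definition _ := [isSub for kernel_val].
HB.instance Definition _ := [Choice of kernel_module by <:].
HB.instance Definition _ := [SubChoice_isSubLmodule of kernel_module by <:].

End Kernel.

(** The hypothesis says that h takes values in the image of g, but g need not be
    onto W.  So projectivity is applied to the pullback of g and h, which maps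
    onto M: a section M -> V x_W M gives the lift. *)
Lemma projective_lift (M V W : lmodType R) (h : {linear M -> W})
    (g : {linear V -> W}) :
  projective M -> (forall y, exists x, g x = h y) ->
  exists k : {linear M -> V}, forall y, g (k y) = h y.
Proof.
move=> projM gh.
have lphi : linear (fun z : V * M => g z.1 - h z.2).
  by move=> a z1 z2; rewrite /= !linearP scalerDr addrACA.
pose phi := linear_of lphi.
have lpi : linear (fun z : kernel_module phi => (val z).2).
  by move=> a z1 z2; rewrite linearP.
have [y|s sK] := projM _ M (linear_of lpi) idfun.
  have [x gx] := gh y.
  have k : (x, y) \in kernel phi by rewrite unfold_in /= gx subrr.
  by exists (KernelElement k).
have lk : linear (fun y => (val (s y)).1) by move=> a y1 y2; rewrite !linearP.
exists (linear_of lk) => y /=.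
have /= := sK y; case: (s y) => z /= zk <-.
by move: zk; rewrite unfold_in /= subr_eq0 => /eqP.
Qed.

Lemma free_decomposition (B : finType) (x : free_module R B) :
  x = \sum_b x b *: basis_vector R b.
Proof.
apply/ffunP => b; rewrite sum_ffunE (bigD1 b) //= big1 ?addr0 => [|b' b'b].
  by rewrite !ffunE eqxx /GRing.scale /= mulr1.
by rewrite !ffunE eq_sym (negPf b'b) scaler0.
Qed.

Lemma free_module_projective (B : finType) : projective (free_module R B).
Proof.
move=> V W g f gsurj.
have /fin_all_exists [v gv] b : exists v, g v = f (basis_vector R b) by [].
have lh : linear (fun x : free_module R B => \sum_b x b *: v b).
  move=> a x y; rewrite scaler_sumr -big_split; apply: eq_bigr => b _.
  by rewrite !ffunE scalerDl scalerA.
exists (linear_of lh) => x /=;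
  rewrite [in RHS](free_decomposition x) !linear_sum.
by apply: eq_bigr => b _; rewrite !linearZ /= gv.
Qed.

Section Comparison.

Variables (L : R -> Prop).
Variables (lenM : nat) (M : nat -> lmodType R) (dM0 : {linear M 0 -> R^o})
  (dM : forall t, {linear M t.+1 -> M t}).
Variables (lenE : nat) (E : nat -> lmodType R) (dE0 : {linear E 0 -> R^o})
  (dE : forall t, {linear E t.+1 -> E t}).
Hypothesis projM : forall t, projective (M t).
Hypothesis resM : resolution L lenM dM0 dM.
Hypothesis resE : resolution L lenE dE0 dE.

Lemma resolution_aug_d x : dM0 (dM 0 x) = 0.
Proof. by case: resM => _ + _ _; move=> /(_ (dM 0 x)) [_]; apply; exists x. Qed.

Lemma resolution_d_d t x : dM t (dM t.+1 x) = 0.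
Proof. by case: resM => _ _ + _; move=> /(_ t (dM t.+1 x)) [_]; apply;
  exists x. Qed.

(** Each map is a lift through a differential of E.  The lift exists because the
    map to be lifted lands in the kernel of the next differential, which is the
    image of the one lifted through. *)
Lemma comparison_map : exists f : forall t, {linear M t -> E t},
  (forall x, dE0 (f 0 x) = dM0 x) /\
  forall t x, dE t (f t.+1 x) = f t (dM t x).
Proof.
case: resE => imE ex0 ex _; case: resM => imM _ _ _.
have [y|f0 f0E] := projective_lift (h := dM0) (g := dE0) (@projM 0).
  by apply/imE/imM; exists y.
have [y|f1 f1E] := projective_lift (h := f0 \o dM 0) (g := dE 0) (@projM 1).
  by apply/ex0; rewrite /= f0E resolution_aug_d.
have [t f f' ff'|f [f0_ fE]] := dependent_choice_nat
  (X := fun t => {linear M t -> E t})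
    (rel := fun t f f' => forall x, dE t (f' x) = f (dM t x)) _ f1E.
  have [y|f'' f''E] := projective_lift (h := f' \o dM t.+1) (g := dE t.+1)
    (@projM _); last by exists f''.
  by apply/ex; rewrite /= ff' resolution_d_d linear0.
by exists f; split=> [x|//]; rewrite f0_.
Qed.

(** The terms of the homotopy are built upwards: the next one lifts the cycle
    that remains of u after removing the part due to the preceding one. *)
Lemma null_homotopy (u : forall t, {linear M t -> E t}) :
  (forall x, dE0 (u 0 x) = 0) -> (forall t x, dE t (u t.+1 x) = u t (dM t x)) ->
  exists s : forall t, {linear M t -> E t.+1},
    forall t x, dE t.+1 (s t.+1 x) = u t.+1 x - s t (dM t x).
Proof.
move=> u0 uE; case: resE => imE ex0 ex _.
have [y|s0 s0E] := projective_lift (h := u 0) (g := dE 0) (@projM 0).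
  exact/ex0.
have [y|s1 s1E] := projective_lift (h := u 1 \- (s0 \o dM 0)) (g := dE 1)
  (@projM 1).
  by apply/ex; rewrite /= linearB /= s0E uE subrr.
have [t s s' ss'|s [_ sE]] := dependent_choice_nat
  (X := fun t => {linear M t -> E t.+1})
  (rel := fun t s s' => forall x, dE t.+1 (s' x) = u t.+1 x - s (dM t x)) _ s1E;
    last by exists s.
have [y|s'' s''E] := projective_lift (h := u t.+2 \- (s' \o dM t.+1))
  (g := dE t.+2) (@projM _); last by exists s''.
by apply/ex; rewrite /= linearB /= ss' uE resolution_d_d linear0 subr0 subrr.
Qed.

End Comparison.

(** If Q is shorter than F, then id - g f is homotopic to 0 and, in the last
    degree of F, both f and the part of the homotopy going up vanish.  So
    id = s d there, and applying ev to a diagonal entry yields 1 = 0. *)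
Lemma minimal_length_le (S : nzRingType) (ev : {rmorphism R -> S})
  (L : R -> Prop)
    (len : nat) (B : nat -> finType)
    (d0 : {linear free_module R (B 0) -> R^o})
    (d : forall t, {linear free_module R (B t.+1) -> free_module R (B t)}) :
  resolution (M := fun t => free_module R (B t)) L len d0 d ->
  (forall t x b, ev (d t x b) = 0) -> B len ->
  forall j, has_projective_resolution L j -> (len <= j)%N.
Proof.
move=> resF minF b j [Q [e0 [e [projQ resQ]]]].
case: len b resF => // l b resF; rewrite leqNgt; apply/negP => jl.
have projF t : projective (free_module R (B t)) by apply:
  free_module_projective.
have [f [f0 fE]] := comparison_map projF resF resQ.
have [g [g0 gE]] := comparison_map projQ resQ resF.
have [x|t x|s sE] := null_homotopy projF resF resF
  (u := fun t => idfun \- (g t \o f t)).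
- by rewrite /= linearB /= g0 f0 subrr.
- by rewrite /= linearB /= gE fE.
have idE x : x = s l (d l x).
  have s0 : s l.+1 x = 0 by case: resF => _ _ _; apply.
  have f0' : f l.+1 x = 0 by case: resQ => _ _ _; apply.
  have /= := sE l x; rewrite s0 f0' !linear0 addr0.
  by move/esym/eqP; rewrite subr_eq0 => /eqP.
have := oner_neq0 S; rewrite -(rmorph1 ev) => /eqP; apply.
have -> : 1 = basis_vector R b b :> R by rewrite ffunE eqxx.
rewrite [basis_vector R b]idE {1}(free_decomposition (d l _)) linear_sum
  sum_ffunE.
rewrite rmorph_sum big1 // => b' _.
by rewrite linearZ ffunE rmorphM minF mul0r.
Qed.

End Modules.

(** * Multigrading, minimality and the formula on the basis *)

Lemma irrelevant_ideal_mcoeff0 (K : fieldType) N (f : {mpoly K[N]}) :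
  irrelevant_ideal f -> f@_0 = 0.
Proof.
case=> c ->; rewrite raddf_sum big1 // => i _ /=.
rewrite mcoeffMXE; case: ifP => // /mnm_lepP /(_ i).
by rewrite mnm1E eqxx mnm0E.
Qed.

Section Assembly.

Variables (n : nat) (disp : Order.disp_t) (P : finPOrderType disp) (m : nat).
Variables (p : 'I_m -> P) (A : 'I_m -> {set 'I_n}).
Variable I : {set {ffun P -> 'I_n}}.
Variable K : fieldType.
Hypothesis p_bij : bijective p.
Hypothesis p_num : forall i j : 'I_m, (p i < p j)%O -> (i < j)%N.
Hypothesis I_ideal : poset_ideal (@le_map disp P n) (isotone_maps p A) I.

Local Notation E := ('I_m * 'I_n)%type.
Local Notation N := (nvars P n).
Local Notation F := (symbol_module K p A I).
Local Notation gdeg := (fun t (s : symbol p A I t) => symbol_mdeg p (val s)).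

Lemma symbol_mdegE (s : {ffun 'I_m -> {set 'I_n}}) :
  symbol_mdeg p s = cell_mdeg p (OmegaBar s).
Proof.
rewrite /symbol_mdeg /cell_mdeg pair_big_dep.
by apply: eq_bigl => -[i a]; rewrite inE.
Qed.

Lemma X_symbolE (s : {ffun 'I_m -> {set 'I_n}}) :
  X_symbol K p s = 'X_[cell_mdeg p (OmegaBar s)] :> {mpoly K[N]}.
Proof.
rewrite /X_symbol /cell_mdeg -mprodXE pair_big_dep.
by apply: eq_bigl => -[i a]; rewrite inE.
Qed.

Lemma homogeneous_strand t alpha (c : F t) beta T :
  homogeneous (@gdeg t) alpha c -> strand p beta (chain_of c) T != 0 ->
  forall i, (beta i)%:Z = alpha i.
Proof.
move=> hc; rewrite /strand; case: ifP => [le|_]; last by rewrite eqxx.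
have [c0|/(chain_of_support p_bij p_num I_ideal)[cT kT]] :=
  eqVneq (chain_of c T) 0.
  by rewrite c0 mcoeff0 eqxx.
have [s sT] := symbol_of_cell p_bij p_num I_ideal cT kT.
rewrite -sT chain_ofE -mcoeff_msupp => /hc h i; rewrite -(h i) symbol_mdegE.
by move/mnm_lepP: le => /(_ i); rewrite mnmBE -sT; lia.
Qed.

Lemma aug_homogeneous alpha (c : F 0) :
  homogeneous (@gdeg 0) alpha c -> homogeneous_poly alpha (aug c).
Proof.
move=> hc u; rewrite mcoeff_msupp mcoeff_aug // => /sum_neq0 [T _].
exact: homogeneous_strand.
Qed.

(** Read on strands: if the multidegree beta occurs in diff c, then it occurs in
    c, since the boundary of a zero strand is zero. *)
Lemma diff_homogeneous t alpha (c : F t.+1) :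
  homogeneous (@gdeg t.+1) alpha c -> homogeneous (@gdeg t) alpha (diff c).
Proof.
move=> hc s u; rewrite mcoeff_msupp ffunE symbol_mdegE => us i.
rewrite -PoszD -mnmDE; move: i; set T := OmegaBar _ in us *.
suff [x] : exists x, strand p (u + cell_mdeg p T) (chain_of c) (x |: T) != 0.
  exact: homogeneous_strand.
suff /boundary_neq0 [_ [x _ ?]] : boundary (@var_gt n m) (@rowful n m) (fun=> 1)
    (strand p (u + cell_mdeg p T) (chain_of c)) T != 0 by exists x.
by rewrite -strand_boundary /strand lem_addl addmK.
Qed.

Lemma diff_minimal t (c : F t.+1) s : irrelevant_ideal (diff c s).
Proof.
rewrite ffunE /boundary; case: ifP => _; last exact: ideal_gen0.
apply: big_ind => [||x _]; [exact: ideal_gen0|exact: ideal_genD|].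
rewrite mulrAC; exact: (ideal_gen_mul (fun i : 'I_N => 'X_i : {mpoly K[N]})).
Qed.

Lemma OmegaBar_del (s : {ffun 'I_m -> {set 'I_n}}) x :
  OmegaBar (symbol_del s x) = OmegaBar s :\ x.
Proof.
case: x => j b; apply/setP => -[i a]; rewrite !inE ffunE xpair_eqE /=.
by case: eqVneq; rewrite ?inE.
Qed.

(** Links two descriptions of the terms of the differential: rows with at least
    two elements, in [Omega], and faces that remain in the family [rowful] over
    which the boundary is taken. *)
Lemma mem_Omega (s : {ffun 'I_m -> {set 'I_n}}) x : rowful (OmegaBar s) ->
  (x \in Omega s) = (x \in OmegaBar s) && rowful (OmegaBar s :\ x).
Proof.
move=> rs; rewrite !inE andbC; have [xs|//] := boolP (x.2 \in s x.1).
rewrite /= (cardsD1 x.2) xs add1n ltnS card_gt0; apply/set0Pn/rowfulP.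
  case=> b; rewrite !inE => /andP[bx bs] i; have [->|ix] := eqVneq i x.1.
    exists b; rewrite !inE bs andbT; apply: contraNneq bx => <- //.
  case/rowfulP/(_ i): rs => a; rewrite inE /= => a_s; exists a;
    rewrite !inE a_s andbT.
  by apply: contraNneq ix => <-.
move/(_ x.1) => [b]; rewrite !inE /= => /andP[bx bs]; exists b;
  rewrite !inE bs andbT.
by apply: contraNneq bx => ->; rewrite -surjective_pairing.
Qed.

Lemma Omega_neq0 t (s : symbol p A I t.+1) : exists x, x \in Omega (val s).
Proof.
have [cs ks] := symbolP p_bij p_num I_ideal s.
have [x xs|none] := pickP (mem (Omega (val s))); first by exists x.
suff : (m + t.+1 <= m)%N by rewrite addnS ltnNge leq_addr.
rewrite -ks card_OmegaBar -[X in (_ <= X)%N]card_ord -sum1_card.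
apply: leq_sum => i _; rewrite leqNgt; apply/negP => gt1.
have /card_gt0P [a a_s] : (0 < #|val s i|)%N by apply: ltnW.
by have := none (i, a); rewrite !inE /= gt1 a_s.
Qed.

Lemma exists_face t (s : symbol p A I t.+1) x : x \in Omega (val s) ->
  exists s' : symbol p A I t, val s' = symbol_del (val s) x.
Proof.
have [cs ks] := symbolP p_bij p_num I_ideal s.
have rs : rowful (OmegaBar (val s)) by case/and4P: cs.
rewrite mem_Omega // => /andP[xs rx].
have [|s' s'E] := symbol_of_cell p_bij p_num I_ideal (t := t)
  (is_cell_sub rx (subsetDl _ _) cs).
  by have := cardsD1 x (OmegaBar (val s)); rewrite ks xs addnS => -[].
by exists s'; apply: OmegaBar_inj; rewrite OmegaBar_del.
Qed.

Lemma diff_basis t (s : symbol p A I t.+1) :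
  exists face : 'I_m * 'I_n -> symbol p A I t,
    (forall x, x \in Omega (val s) -> val (face x) = symbol_del (val s) x) /\
    diff (basis_vector {mpoly K[N]} s) =
      \sum_(x in Omega (val s))
         ((-1) ^+ sigma x (OmegaBar (val s)) * Xvar K (p x.1) x.2) *:
         basis_vector {mpoly K[N]} (face x).
Proof.
have [x0 /exists_face [s0 _]] := Omega_neq0 s.
have /fin_all_exists [face faceE] x : exists s' : symbol p A I t,
    x \in Omega (val s) -> val s' = symbol_del (val s) x.
  by have [/exists_face [s' ?]|] := boolP (x \in Omega (val s));
    [exists s'|exists s0].
exists face; split=> //; apply/ffunP => s'; rewrite sum_ffunE ffunE /boundary.
have [cs ks] := symbolP p_bij p_num I_ideal s.
have [cs' ks'] := symbolP p_bij p_num I_ideal s'.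
have rs : rowful (OmegaBar (val s)) by case/and4P: cs.
have rs' : rowful (OmegaBar (val s')) by case/and4P: cs'.
rewrite rs' big_mkcond [RHS]big_mkcond; apply: eq_bigr => x _.
have chainE T : chain_of (basis_vector {mpoly K[N]} s) T =
  (OmegaBar (val s) == T)%:R.
  rewrite /chain_of; have [<-|sT] := eqVneq (OmegaBar (val s)) T; last first.
    rewrite big1 // => r /eqP rT; rewrite ffunE; case: eqVneq => // rs''.
    by rewrite -rs'' rT eqxx in sT.
  by rewrite -/(chain_of _ _) chain_ofE ffunE eqxx.
rewrite chainE; have [xO|xO] := boolP (x \in Omega (val s)); last first.
  case: ifP => // xs'; case: eqP => [sE|_]; last by rewrite mulr0.
  by case/negP: xO; rewrite mem_Omega // sE setU11 setU1K.
have xs : x \in OmegaBar (val s) by move: xO; rewrite mem_Omega // => /andP[].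
have faceT : OmegaBar (val (face x)) = OmegaBar (val s) :\ x.
  by rewrite faceE // OmegaBar_del.
rewrite !ffunE; have [->|ne] := eqVneq s' (face x).
  rewrite faceT !inE eqxx setD1K // eqxx /GRing.scale /= !mulr1;
    congr (_ ^+ _ * _).
  rewrite -[LHS]add0n -[X in sigma x X](setD1K xs) /sigma.
  rewrite -[RHS]/(rank_in _ _ _) rank_inU1 ?inE ?eqxx //.
  by rewrite /var_gt !ltnn andbF.
rewrite scaler0; case: ifP => // xs'; rewrite (_ : (_ == _) = false) ?mulr0 //.
apply: contraNF ne => /eqP sE; rewrite -val_eqE /=;
  apply/eqP/(@OmegaBar_inj n m).
by rewrite faceT sE setU1K.
Qed.

Lemma is_symbol_leq t s : is_symbol p A I t s -> (t <= m * n)%N.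
Proof.
rewrite is_symbolE // => /andP[_ /eqP kT]; apply: leq_trans (leq_addl m t) _.
by rewrite -kT (leq_trans (max_card _)) // card_prod !card_ord.
Qed.

Lemma max_symbol_degree : exists len, (exists s, is_symbol p A I len s) /\
  forall t s, is_symbol p A I t s -> (t <= len)%N.
Proof.
case: (I_ideal) => /set0Pn [f fI] _ _.
have ex : exists t, [exists s, is_symbol p A I t s].
  by exists 0%N; apply/existsP; eexists;
    apply: is_symbol_map p_bij p_num I_ideal _ fI.
have ub t : [exists s, is_symbol p A I t s] -> (t <= m * n)%N.
  by move=> /existsP[s /is_symbol_leq].
case: (ex_maxnP ex ub) => len /existsP lenP lenmax; exists len;
  split=> // t s ts.
by apply: lenmax; apply/existsP; exists s.
Qed.

Lemma symbol_resolution len :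
  (forall t s, is_symbol p A I t s -> (t <= len)%N) ->
  resolution (M := fun t => free_module {mpoly K[N]} (symbol p A I t))
    (coletterplace K I) len (@aug n disp P m p A I K)
      (@diff n disp P m p A I K).
Proof.
move=> len_max; split.
- exact: aug_image.
- move=> c; split=> [c0|[y <-]]; last exact: aug_diff.
  apply: diff_exact => // [S|_ alpha].
    apply/eqP/negPn/negP => /boundary_neq0 [/card_rowful mS [x xS]].
    case/(chain_of_support p_bij p_num I_ideal) => _.
    by rewrite cardsU1 xS addn0 => /eq_leq/leq_trans/(_ mS); rewrite ltnn.
  by rewrite -mcoeff_aug // c0 mcoeff0.
- move=> t c; split=> [c0|[y <-]]; last exact: diff_diff.
  apply: diff_exact => // S; rewrite -chain_of_diff // c0.
  by rewrite /chain_of big1 // => s _; rewrite ffunE.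
- move=> t c lt_t; apply/ffunP => s.
  by have := len_max t _ (valP s); rewrite leqNgt lt_t.
Qed.

End Assembly.

Theorem theorem1p3 (K : fieldType) (n : nat) (n_gt0 : (0 < n)%N)
    (disp : Order.disp_t) (P : finPOrderType disp) (m : nat)
    (p : 'I_m -> P) (p_bij : bijective p)
    (p_num : forall i j : 'I_m, (p i < p j)%O -> (i < j)%N)
    (A : 'I_m -> {set 'I_n}) (A_neq0 : forall i, A i != set0)
    (I : {set {ffun P -> 'I_n}})
    (I_ideal : poset_ideal (@le_map disp P n) (isotone_maps p A) I) :
  exists (len : nat)
         (d0 : {linear symbol_module K p A I 0 -> {mpoly K[nvars P n]}^o})
         (d : forall t, {linear symbol_module K p A I t.+1 ->
                                symbol_module K p A I t}),
    [/\ (exists s, is_symbol p A I len s) /\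
        (forall t s, is_symbol p A I t s -> (t <= len)%N),
        projective_dimension (coletterplace K I) len,
        multigraded_minimal_free_resolution (coletterplace K I) len
          (fun t (s : symbol p A I t) => symbol_mdeg p (val s)) d0 d,
        forall s : symbol p A I 0,
          d0 (basis_vector _ s) = X_symbol K p (val s)
      & forall (t : nat) (s : symbol p A I t.+1),
          exists face : 'I_m * 'I_n -> symbol p A I t,
            (forall x, x \in Omega (val s) ->
               val (face x) = symbol_del (val s) x) /\
            d t (basis_vector _ s) =
              \sum_(x in Omega (val s))
                 ((-1) ^+ sigma x (OmegaBar (val s)) * Xvar K (p x.1) x.2) *:
                 basis_vector {mpoly K[nvars P n]} (face x)].
Proof.
have [len [[s0 len_s0] len_max]] := max_symbol_degree p_bij p_num I_ideal.
have res := symbol_resolution K p_bij p_num I_ideal len_max.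
exists len, (@aug n disp P m p A I K), (@diff n disp P m p A I K); split.
- by split=> //; exists s0.
- split.
    do 3!eexists; split; last exact: res.
    by move=> t; apply: free_module_projective.
  apply: (minimal_length_le (ev := mcoeff 0%MM) res).
    by move=> t x b; apply/irrelevant_ideal_mcoeff0/diff_minimal.
  by exists s0.
- split=> //.
  + by move=> alpha x; apply: aug_homogeneous.
  + by move=> t alpha x; apply: diff_homogeneous.
  + exact: diff_minimal.
- by move=> s; rewrite X_symbolE; apply: aug_basis.
- by move=> t s; apply: diff_basis.
Qed.
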